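(* Let $l,u:\Xi\to[0,+\infty]$ be measurable with $l\le u$, and let $$\mathcal{D}:=\left\{p\in\mathcal{L}\ :\ l(\xi)\le p(\xi)\le u(\xi)\ \ \forall\,\xi\in\Xi,\ \ \int_\Xi p(\xi)\,d\xi=1\right\}.$$ Assume that $\int_\Xi|f(x,\xi)|\,u(\xi)\,d\xi<\infty$ for all $x\in\mathcal{X}$ and that $\mathcal{D}\ne\emptyset$. Then for every $x\in\mathcal{X}$, $$\sup_{p\in\mathcal{D}}\int_\Xi f(x,\xi)p(\xi)\,d\xi=\inf_{\lambda\in\mathbb{R}}\left\{\lambda-\int_\Xi l(\xi)\,(f(x,\xi)-\lambda)_-\,d\xi+\int_\Xi u(\xi)\,(f(x,\xi)-\lambda)_+\,d\xi\right\},$$ and consequently $$\inf_{x\in\mathcal{X}}\ \sup_{p\in\mathcal{D}}\int_\Xi f(x,\xi)p(\xi)\,d\xi=\inf_{x\in\mathcal{X},\,\lambda\in\mathbb{R}}\left\{\lambda-\int_\Xi l(\xi)\,(f(x,\xi)-\lambda)_-\,d\xi+\int_\Xi u(\xi)\,(f(x,\xi)-\lambda)_+\,d\xi\right\}.$$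
   Context: $\Xi\subseteq\mathbb{R}^m$ is a measurable set (the support of the random parameter), $\mathcal{X}\subseteq\mathbb{R}^n$ is the feasible set, and $f:\mathbb{R}^n\times\mathbb{R}^m\to\mathbb{R}$ is the objective function, with $f(x,\cdot)$ measurable for each $x\in\mathcal{X}$. $\mathcal{L}$ is the space of all non-negative Lebesgue-measurable functions on $\mathbb{R}^m$. Notation: $(z)_-:=\max\{-z,0\}$ and $(z)_+:=\max\{z,0\}$. The convention $0\cdot\infty=0$ is used in integrands, and the expression in braces may equal $+\infty$ for some $\lambda$. *)

(* Defs.v *)
From HB Require Import structures.
From mathcomp Require Import all_boot all_order all_algebra.
From mathcomp Require Import all_classical all_reals all_analysis.
From mathcomp Require Import measurable_realfun.

Set Implicit Arguments.
Unset Strict Implicit.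
Unset Printing Implicit Defensive.

Import Order.TTheory GRing.Theory Num.Theory.
Import numFieldNormedType.Exports.

Local Open Scope classical_set_scope.
Local Open Scope ring_scope.

Section lebesgue_rV.
Context (R : realType) (m : nat).
Local Open Scope ereal_scope.
Implicit Types (A : set 'rV[R]_m) (C : set ('rV[R]_m * 'rV[R]_m)).

Definition box (ab : 'rV[R]_m * 'rV[R]_m) : set 'rV[R]_m :=
  [set x | forall i, (ab.1 ord0 i < x ord0 i <= ab.2 ord0 i)%R].

(* The truncation at 0 gives volume 0 to a box whose endpoints are reversed
   in some coordinate (such a box is empty). *)
Definition box_volume (ab : 'rV[R]_m * 'rV[R]_m) : R :=
  (\prod_(i < m) Num.max (ab.2 ord0 i - ab.1 ord0 i) 0)%R.

(* Lebesgue outer measure on R^m. Covers are countable sets of boxes rather than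
   sequences: for m = 0 the only box is the whole point, of volume 1, and the
   empty set needs the empty cover. *)
Definition lebesgue_outer (A : set 'rV[R]_m) : \bar R :=
  ereal_inf [set \esum_(ab in C) (box_volume ab)%:E | C in
    [set C | countable C /\ A `<=` \bigcup_(ab in C) box ab]].

Lemma box_volume_ge0 ab : (0 <= box_volume ab)%R.
Proof. by apply: prodr_ge0 => i _; rewrite le_max lexx orbT. Qed.

Lemma lebesgue_outer_ge0 A : 0 <= lebesgue_outer A.
Proof.
apply: le_ereal_inf_tmp => _ [C _ <-].
by apply: esum_ge0 => ab _; rewrite lee_fin box_volume_ge0.
Qed.

Lemma lebesgue_outer0 : lebesgue_outer set0 = 0.
Proof.
apply/eqP; rewrite eq_le lebesgue_outer_ge0 andbT.
apply: ereal_inf_lbound; exists set0; last by rewrite esum_set0.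
by split => //; exact: countable0.
Qed.

Lemma le_lebesgue_outer :
  {homo lebesgue_outer : A B / A `<=` B >-> A <= B}.
Proof.
move=> A B AB; apply: ereal_inf_le_tmp => _ [C [cC BC] <-].
by exists C => //; split=> //; exact: subset_trans BC.
Qed.

Lemma lebesgue_outer_sigma_subadditive : sigma_subadditive lebesgue_outer.
Proof.
move=> A.
have [[i Aioo]|Afin] := pselect (exists i, lebesgue_outer (A i) = +oo).
  rewrite (eseries_pinfty _ _ Aioo) ?leey// => n _.
  by rewrite -ltNye (lt_le_trans _ (lebesgue_outer_ge0 _)).
apply/lee_addgt0Pr => e e0.
apply: le_trans (epsilon_trick xpredT _ (ltW e0)); last first.
  by move=> n; exact: lebesgue_outer_ge0.
have coverP n : exists C, [/\ countable C, A n `<=` \bigcup_(ab in C) box ab &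
    \esum_(ab in C) (box_volume ab)%:E <=
    lebesgue_outer (A n) + (e / (2 ^ n.+1)%:R)%:E].
  have Anfin : lebesgue_outer (A n) \is a fin_num.
    rewrite ge0_fin_numE ?lebesgue_outer_ge0// ltey; apply/eqP => Anoo.
    by apply: Afin; exists n.
  have en0 : (0 < e / (2 ^ n.+1)%:R)%R by rewrite divr_gt0// ltr0n expn_gt0.
  have [_ [C [cC AC] <-] lt_C] := lb_ereal_inf_adherent en0 Anfin.
  by exists C; split => //; exact: ltW.
have [C CP] := choice coverP.
have vol0 ab : 0 <= (box_volume ab)%:E by rewrite lee_fin box_volume_ge0.
apply: (@le_trans _ _ (\esum_(ab in \bigcup_n C n) (box_volume ab)%:E)).
  apply: ereal_inf_lbound; exists (\bigcup_n C n) => //; split.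
    by apply: bigcup_countable => // n _; have [] := CP n.
  move=> x [n _ Anx]; have [_ /(_ x Anx)[ab Cab xab] _] := CP n.
  by exists ab => //; exists n.
rewrite seqDU_bigcup_eq (nneseries_sum_bigcup (trivIset_seqDU C) vol0).
apply: lee_nneseries => n _ //; first by move=> _; exact: esum_ge0.
have [_ _] := CP n; apply: le_trans.
apply: ge_ereal_sup => _ [X [finX XC] <-]; apply: ereal_sup_ubound.
by exists X => //; split => //; exact: subset_trans (@subset_seqDU _ _ _).
Qed.

HB.instance Definition _ := isOuterMeasure.Build R 'rV[R]_m lebesgue_outer
  lebesgue_outer0 lebesgue_outer_ge0 le_lebesgue_outer
  lebesgue_outer_sigma_subadditive.

(* 'rV[R]_m equipped with the sigma-algebra of Lebesgue (that is, Caratheodory)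
   measurable sets, and Lebesgue measure on it. *)
Definition lebesgue_rV : measurableType (caratheodory_display lebesgue_outer) :=
  caratheodory_type lebesgue_outer.

Definition lebesgue_rV_measure : set lebesgue_rV -> \bar R := lebesgue_outer.

HB.instance Definition _ := isMeasure.Build _ lebesgue_rV R lebesgue_rV_measure
  (caratheodory_measure0 lebesgue_outer)
  (@caratheodory_measure_ge0 _ _ lebesgue_outer)
  (@caratheodory_measure_sigma_additive _ _ lebesgue_outer).

End lebesgue_rV.

Arguments lebesgue_rV_measure : clear implicits.

Section density_bounds.
Context (R : realType) (m : nat) (Xi : set (lebesgue_rV R m)).
Variables (l u : lebesgue_rV R m -> \bar R).
Local Open Scope ereal_scope.
Local Notation mu := (lebesgue_rV_measure R m).

(* Densities are real-valued functions on all of R^m, whereas the bounds take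
   values in [0, +oo] and only matter on Xi. *)
Definition densities : set (lebesgue_rV R m -> R) :=
  [set p : lebesgue_rV R m -> R |
    [/\ measurable_fun setT p,
        forall xi, (0 <= p xi)%R,
        forall xi, Xi xi -> l xi <= (p xi)%:E <= u xi &
        \int[mu]_(xi in Xi) (p xi)%:E = 1]].

Definition worst_case (g : lebesgue_rV R m -> R) : \bar R :=
  ereal_sup [set \int[mu]_(xi in Xi) (g xi * p xi)%:E | p in densities].

(* The product of \bar R satisfies 0 * +oo = 0; ^\- and ^\+ are the
   (nonnegative) negative and positive parts. *)
Definition dual_objective (g : lebesgue_rV R m -> R) (lambda : R) : \bar R :=
  lambda%:E
  - \int[mu]_(xi in Xi) (l xi * ((g \- cst lambda)^\-%R xi)%:E)
  + \int[mu]_(xi in Xi) (u xi * ((g \- cst lambda)^\+%R xi)%:E).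

End density_bounds.

(* Main.v *)
Require Import Defs.
From mathcomp Require Import all_boot all_order all_algebra.
From mathcomp Require Import all_classical all_reals all_analysis.
From mathcomp Require Import measurable_realfun.
From mathcomp Require Import lra.

Set Implicit Arguments.
Unset Strict Implicit.
Import Order.TTheory GRing.Theory Num.Theory.
Import numFieldNormedType.Exports.

Local Open Scope classical_set_scope.
Local Open Scope ring_scope.
Local Open Scope ereal_scope.

(** Fix x, write g for f x, and write a density as p = l + q with
    0 <= q <= w, where w = u - l, so that the total mass of q is the prescribed
    number c = 1 - int l. For p feasible and any lambda, the dual objective
    exceeds the primal value by exactly

      int (p - l) (g - lambda)^- + int (u - p) (g - lambda)^+    (the slack),

    which is nonnegative ([dual_valueE], [weak_duality]). The two sides of
    the theorem therefore agree as soon as the slack can be made arbitrarily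
    small, and this is the bathtub principle ([bathtub]): pour q into the
    highest superlevel sets of g until the mass c is used up. With
    B(lambda) = int_{g > lambda} w, nonincreasing in lambda, pick lambda with
    B(lambda) <= c <= B(lambda - e); let q be w on {g > lambda}, zero outside
    {g > lambda - e}, and something between 0 and w on the slab between them.
    Only the slab contributes to the slack, at most e * c. No such lambda need
    exist when c = 0 or c = int w; there q = 0, respectively q = w, and
    lambda is sent to +oo, respectively -oo, the slack vanishing by dominated
    convergence ([tail_vanishes]).

    Working with a slab of positive width instead of the level set at a
    critical lambda matters: the primal supremum need not be attained (mass may
    escape to infinity along {-e < g <= 0} when u is not integrable there).

    Choosing q on the slab, where w may be infinite or have infinite integral,
    requires w to have minorants of any prescribed finite mass below its
    integral ([exists_minorant]). This would fail for a measure with infinite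
    atoms, so Lebesgue measure is shown to be sigma-finite
    ([lebesgue_rV_sigma_finite]): half-spaces are Caratheodory measurable since
    cutting a box by a coordinate hyperplane preserves total volume, hence
    boxes are measurable. *)

(** * Prescribing the mass of a function below a given one *)

Section bathtub.
Context d (T : measurableType d) (R : realType) (mu : {measure set T -> \bar R})
  (sfmu : sigma_finite [set: T] mu).
Implicit Types (w : T -> \bar R) (g q v : T -> R).

Lemma truncation_cvg (w : T -> \bar R) (F : (set T)^nat) x :
  (forall n m : nat, (n <= m)%N -> F n `<=` F m) -> (\bigcup_n F n) x -> 0 <= w x ->
  ((fun y => mine (w y) n%:R%:E) \_ (F n)) x @[n --> \oo] --> w x.
Proof.
move=> ndF [N _ FNx] wx0.
have eqF : \forall n \near \oo, mine (w x) n%:R%:E =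
    ((fun y => mine (w y) n%:R%:E) \_ (F n)) x.
  near=> n; rewrite patchE mem_set//; apply: ndF FNx.
  by near: n; exact: nbhs_infty_ge.
apply: cvg_trans; first exact: near_eq_cvg eqF.
case: (w x) wx0 => [r _|_|//]; last first.
  rewrite (_ : (fun _ => _) = (fun n => n%:R%:E)); last first.
    by apply/funext => n; apply/min_idPr; rewrite leey.
  by apply/cvgeyPge => A; near do rewrite lee_fin; exact: nbhs_infty_ger.
apply: cvg_near_cst; near=> n; apply/min_idPl; rewrite lee_fin.
by near: n; exact: nbhs_infty_ger.
Unshelve. all: by end_near. Qed.

(** If the integral of w is finite, w is finite almost everywhere and its real
    part works. Otherwise the truncations of w in height and support, which are
    integrable by sigma-finiteness, increase to w and eventually have
    mass at least c. *)
Lemma exists_minorant_fin w (c : R) :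
  measurable_fun setT w -> (forall x, 0 <= w x) -> c%:E <= \int[mu]_x w x ->
  exists v : T -> R, [/\ measurable_fun setT v, forall x, (0 <= v x)%R,
    forall x, (v x)%:E <= w x, c%:E <= \int[mu]_x (v x)%:E &
    \int[mu]_x (v x)%:E < +oo].
Proof.
move=> mw w0 cw.
(* the real part of a nonnegative integrable function keeps its integral *)
have finew (h : T -> \bar R) : measurable_fun setT h -> (forall x, 0 <= h x) ->
    \int[mu]_x h x < +oo ->
    [/\ measurable_fun setT (fine \o h), forall x, (0 <= fine (h x))%R,
      forall x, (fine (h x))%:E <= h x &
      \int[mu]_x (fine (h x))%:E = \int[mu]_x h x].
  move=> mh h0 hoo; have mfh : measurable_fun setT (fine \o h).
    exact: measurableT_comp.
  split => //; first by move=> x; exact: fine_ge0.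
    by move=> x; have := h0 x; case: (h x) => //= r; rewrite ?leey.
  apply: ae_eq_integral => //; first exact/measurable_EFinP.
  have ih : mu.-integrable setT h.
    apply/integrableP; split => //.
    by under eq_integral do rewrite gee0_abs//.
  apply: filterS (integrable_ae measurableT ih) => x hx _.
  by rewrite fineK// hx.
have [woo|woo] := ltP (\int[mu]_x w x) +oo.
  have [? ? ? e] := finew _ mw w0 woo.
  by exists (fine \o w); split => //=; rewrite e.
have [F [TF ndF mF]] := (sigma_finiteP _ _).1 sfmu.
have ndF' (n m : nat) : (n <= m)%N -> F n `<=` F m by move/ndF/subsetPset.
pose h n := (fun y => mine (w y) n%:R%:E) \_ (F n).
have mh n : measurable_fun setT (h n).
  apply/measurable_restrict => //; first by case: (mF n).
  by apply: measurable_funTS; exact: measurable_mine.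
have h0 n x : 0 <= h n x.
  by rewrite /h patchE; case: ifP => // _; rewrite le_min w0 lee_fin ler0n.
have hw n x : h n x <= w x.
  by rewrite /h patchE; case: ifP => // _; rewrite ge_min lexx.
have hoo n : \int[mu]_x h n x < +oo.
  rewrite -integral_mkcond.
  apply: (@le_lt_trans _ _ (\int[mu]_(x in F n) (cst n%:R%:E x))).
    apply: ge0_le_integral => //=; first by case: (mF n).
    - by move=> x _; rewrite le_min w0 lee_fin ler0n.
    - by apply: measurable_funTS; exact: measurable_mine.
    - by move=> x _; rewrite ge_min lexx orbT.
  rewrite integral_cst//; last by case: (mF n).
  by rewrite lte_mul_pinfty//; case: (mF n).
have [[n cn]|H] := pselect (exists n, c%:E <= \int[mu]_x h n x).
  have [? ? ? e] := finew _ (mh n) (h0 n) (hoo n).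
  exists (fine \o h n); split => //=; rewrite ?e//.
  by move=> x; apply: (le_trans _ (hw n x)).
(* all truncations of mass below c would force the same for their limit w *)
exfalso; move: woo; rewrite leNgt => /negP; apply.
apply: (@le_lt_trans _ _ c%:E); last exact: ltry.
have ndh x : {homo h^~ x : n m / (n <= m)%N >-> n <= m}.
  move=> n m nm; rewrite /h !patchE; case: ifPn => [/set_mem Fnx|_].
    rewrite mem_set; last exact: ndF' Fnx.
    by rewrite le_min !ge_min lexx/= lee_fin ler_nat nm orbT.
  exact: (h0 m x).
have hlim : (fun x => limn (h^~ x)) = w.
  apply/funext => x.
  by apply/cvg_lim => //; apply: truncation_cvg => //; rewrite -TF.
have := cvg_monotone_convergence (mu := mu) measurableT mh (fun n x _ => h0 n x)
  (fun x _ => ndh x).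
rewrite hlim.
move=> cvh; rewrite -(cvg_lim _ cvh)//; apply: lime_le.
  by apply/cvg_ex; eexists; exact: cvh.
apply: nearW => n; rewrite leNgt; apply/negP => /ltW cn; apply: H.
by exists n.
Qed.

(** Scaling down a minorant of finite mass at least c gives mass exactly c. *)
Lemma exists_minorant w (c : R) :
  measurable_fun setT w -> (forall x, 0 <= w x) -> (0 <= c)%R ->
  c%:E <= \int[mu]_x w x ->
  exists v : T -> R, [/\ measurable_fun setT v, forall x, (0 <= v x)%R,
    forall x, (v x)%:E <= w x & \int[mu]_x (v x)%:E = c%:E].
Proof.
move=> mw w0 c0 /(exists_minorant_fin mw w0)[v [mv v0 vw cv voo]].
have vfin : \int[mu]_x (v x)%:E \is a fin_num.
  by rewrite ge0_fin_numE// integral_ge0// => x _; rewrite lee_fin.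
set I := fine (\int[mu]_x (v x)%:E).
have IE : \int[mu]_x (v x)%:E = I%:E by rewrite fineK.
have cI : (c <= I)%R by rewrite -lee_fin -IE.
have I0 : (0 <= I)%R by exact: le_trans cI.
have cI1 : (c / I <= 1)%R.
  have [->|In0] := eqVneq I 0%R; first by rewrite invr0 mulr0.
  by rewrite ler_pdivrMr ?mul1r// lt0r In0.
(* when I = 0, also c = 0 and the convention c / 0 = 0 gives the right answer *)
exists (fun x => c / I * v x)%R; split => [|x|x|].
- exact: measurable_funM.
- by rewrite mulr_ge0// divr_ge0.
- by apply: le_trans (vw x); rewrite lee_fin ler_piMl.
- under eq_integral do rewrite EFinM.
  rewrite ge0_integralZl_EFin//; first last.
  + exact: divr_ge0.
  + exact/measurable_EFinP.
  + by move=> x _; rewrite lee_fin.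
  + rewrite IE -EFinM; have [I00|In0] := eqVneq I 0%R; last by rewrite divfK.
    by congr EFin; rewrite I00 mulr0; apply/eqP; rewrite eq_le c0 -I00 cI.
Qed.

(** The mass c is reached by filling G completely and H outside G partially:
    two minorants are added, one of mass int_G w and one of mass c - int_G w.
    The first has the same finite integral as w on G, hence equals
    it almost everywhere. *)
Lemma exists_interpolation w (G H : set T) (c : R) :
  measurable_fun setT w -> (forall x, 0 <= w x) ->
  measurable G -> measurable H -> G `<=` H ->
  \int[mu]_(x in G) w x <= c%:E -> c%:E <= \int[mu]_(x in H) w x ->
  exists q : T -> R, [/\ measurable_fun setT q,
    forall x, (0 <= q x)%R /\ (q x)%:E <= w x,
    forall x, ~ H x -> q x = 0%R,
    \int[mu]_x (q x)%:E = c%:E &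
    {ae mu, forall x, G x -> (q x)%:E = w x}].
Proof.
move=> mw w0 mG mH GH wGc cwH.
have mr A : measurable A -> measurable_fun setT (w \_ A).
  move=> mA; apply/measurable_restrict => //; exact: measurable_funTS.
have r0 A x : 0 <= (w \_ A) x by rewrite patchE; case: ifP.
have Gfin : \int[mu]_(x in G) w x \is a fin_num.
  rewrite ge0_fin_numE; last by apply: integral_ge0 => x _.
  exact: le_lt_trans wGc (ltry _).
set I := fine (\int[mu]_(x in G) w x).
have IE : \int[mu]_(x in G) w x = I%:E by rewrite fineK.
have I0 : (0 <= I)%R by apply/fine_ge0/integral_ge0 => x _.
have Ic : (0 <= c - I)%R by rewrite subr_ge0 -lee_fin -IE.
have mHG : measurable (H `\` G) by exact: measurableD.
have HGE : \int[mu]_(x in H) w x = I%:E + \int[mu]_(x in H `\` G) w x.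
  rewrite -IE -ge0_integral_setU//; first by rewrite setDUK.
  - by apply: measurable_funTS.
  - by apply/disj_setPS => x [? [_]].
have [|v1 [mv1 v10 v1w v1I]] := exists_minorant (mr _ mG) (r0 G) I0.
  by rewrite -integral_mkcond IE.
have [|v2 [mv2 v20 v2w v2I]] := exists_minorant (mr _ mHG) (r0 (H `\` G)) Ic.
  by rewrite -integral_mkcond EFinB leeBlDl// -HGE.
exists (v1 \+ v2)%R; split => [|x|x nHx||].
- exact: measurable_funD.
- split; first by rewrite /= addr_ge0.
  move: (v1w x) (v2w x); rewrite !patchE /= EFinD; have [Gx|nGx] := pselect (G x).
    rewrite mem_set// memNset; last by case.
    by move=> v1w' v2w'; apply: le_trans (leeD v1w' v2w') _; rewrite adde0.
  rewrite memNset// => v10'; case: ifPn => _ v2w'.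
    by apply: le_trans (leeD v10' v2w') _; rewrite add0e.
  by apply: le_trans (leeD v10' v2w') _; rewrite adde0.
- move: (v1w x) (v2w x); rewrite !patchE !memNset//; last 2 first.
  + by case.
  + by move/GH.
  rewrite !lee_fin => v1x v2x /=.
  by apply/eqP; rewrite paddr_eq0// !eq_le v1x v2x v10 v20.
- under eq_integral do rewrite EFinD.
  rewrite ge0_integralD//; first by rewrite v1I v2I -EFinD subrKC.
  + by move=> x _; rewrite lee_fin.
  + exact/measurable_EFinP.
  + by move=> x _; rewrite lee_fin.
  + exact/measurable_EFinP.
- have : ae_eq mu setT (fun x => (w \_ G) x - (v1 x)%:E) (cst 0).
    apply/ae_eq_integral_abs => //.
      by apply: emeasurable_funB => //; [exact: mr|exact/measurable_EFinP].
    under eq_integral do rewrite gee0_abs ?sube_ge0//.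
    have : \int[mu]_x (w \_ G) x = \int[mu]_x (v1 x)%:E +
       \int[mu]_x ((w \_ G) x - (v1 x)%:E).
      rewrite -ge0_integralD//.
      + by apply: eq_integral => x _; rewrite [RHS]addeC subeK.
      + by move=> x _; rewrite lee_fin.
      + exact/measurable_EFinP.
      + by move=> x _; rewrite sube_ge0.
      + by apply: emeasurable_funB => //; [exact: mr|exact/measurable_EFinP].
    rewrite -integral_mkcond IE v1I => /(congr1 (fun z => z - I%:E)).
    by rewrite subee// [I%:E + _]addeC addeK.
  apply: filterS => x wv10 Gx.
  have wv1 : (w \_ G) x = (v1 x)%:E.
    by rewrite -[LHS](@subeK _ _ (v1 x)%:E)// (wv10 Logic.I) add0e.
  move: wv1 (v2w x); rewrite !patchE mem_set// memNset; last by case.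
  move=> ->; rewrite lee_fin => v2x /=.
  suff -> : v2 x = 0%R by rewrite addr0.
  by apply/eqP; rewrite eq_le v2x v20.
Qed.

(** * The bathtub principle *)

(** With q = p - l and w = u - l this is the difference between the dual
    objective at lam and the primal value at p; it is zero exactly when q
    vanishes on {g < lam} and fills w on {g > lam}, up to null sets. *)
Definition slack w q g (lam : R) : \bar R :=
  \int[mu]_x ((q x)%:E * ((g \- cst lam)^\-%R x)%:E +
              (w x - (q x)%:E) * ((g \- cst lam)^\+%R x)%:E).

Lemma measurable_slack w q g lam :
  measurable_fun setT w -> measurable_fun setT q -> measurable_fun setT g ->
  measurable_fun setT (fun x => (q x)%:E * ((g \- cst lam)^\-%R x)%:E +
              (w x - (q x)%:E) * ((g \- cst lam)^\+%R x)%:E).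
Proof.
move=> mw mq mg; have mgl : measurable_fun setT (g \- cst lam)%R.
  exact: measurable_funB.
apply: emeasurable_funD; apply: emeasurable_funM.
- exact/measurable_EFinP.
- exact/measurable_EFinP/measurable_funrneg.
- by apply: emeasurable_funB => //; exact/measurable_EFinP.
- exact/measurable_EFinP/measurable_funrpos.
Qed.

Lemma slack_integrand_ge0 w q g lam x : (0 <= q x)%R -> (q x)%:E <= w x ->
  0 <= (q x)%:E * ((g \- cst lam)^\-%R x)%:E +
              (w x - (q x)%:E) * ((g \- cst lam)^\+%R x)%:E.
Proof.
move=> q0 qw; rewrite adde_ge0// mule_ge0 ?lee_fin ?funrneg_ge0 ?funrpos_ge0//.
by rewrite sube_ge0.
Qed.

(** On {lam < g} the slack integrand vanishes because w - q does; elsewhere it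
    reduces to q (lam - g), and q is supported where lam - g < e. *)
Lemma slack_le w q g (lam e : R) :
  measurable_fun setT w -> measurable_fun setT q -> measurable_fun setT g ->
  (forall x, (0 <= q x)%R /\ (q x)%:E <= w x) -> (0 <= e)%R ->
  {ae mu, forall x, (lam < g x)%R -> (q x)%:E = w x} ->
  (forall x, ~ (lam - e < g x)%R -> q x = 0%R) ->
  slack w q g lam <= e%:E * \int[mu]_x (q x)%:E.
Proof.
move=> mw mq mg qw e0 qwae q0.
have eq0 x : 0 <= (e * q x)%:E by rewrite lee_fin mulr_ge0//; case: (qw x).
rewrite -ge0_integralZl_EFin//; first last.
- exact/measurable_EFinP.
- by move=> x _; rewrite lee_fin; case: (qw x).
apply: ae_ge0_le_integral => //.
- by move=> x _; case: (qw x) => ? ?; exact: slack_integrand_ge0.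
- exact: measurable_slack.
- by move=> x _; rewrite -EFinM.
- by apply/measurable_EFinP; exact: measurable_funM.
apply: filterS qwae => x qwx _; case: (qw x) => qx0 qwx'.
rewrite /funrneg /funrpos /=; have [glam|lamg] := leP (g x) lam.
  rewrite (@max_r _ _ (g x - lam)%R) ?subr_le0// mule0 adde0 -EFinM.
  rewrite lee_fin mulrC; have [gle|/negP gle] := boolP (lam - e < g x)%R.
    rewrite ler_wpM2r// max_l; lra.
  by rewrite q0// !mulr0.
rewrite -qwx// subee// mul0e adde0 (@max_r _ _ (- _)%R); last by lra.
by rewrite mule0 mule_ge0 ?lee_fin.
Qed.

(** Dominated convergence: w (g - n)^+ is bounded by the integrable |g| w and,
    at each point, vanishes for n large. The latter holds even where w is
    infinite, since the product of +oo and 0 is 0. *)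
Lemma tail_vanishes w g (e : R) :
  measurable_fun setT w -> measurable_fun setT g ->
  (forall x, 0 <= w x) -> \int[mu]_x (`|g x|%:E * w x) < +oo -> (0 < e)%R ->
  exists lam : R, \int[mu]_x (w x * ((g \- cst lam)^\+%R x)%:E) <= e%:E.
Proof.
move=> mw mg w0 gw e0.
pose h (n : nat) x := w x * ((g \- cst n%:R)^\+%R x)%:E.
have h0 n x : 0 <= h n x by rewrite mule_ge0 ?lee_fin ?funrpos_ge0.
have mh n : measurable_fun setT (h n).
  apply: emeasurable_funM => //; apply/measurable_EFinP/measurable_funrpos.
  exact: measurable_funB.
have mgw : measurable_fun setT (fun x => `|g x|%:E * w x).
  apply: emeasurable_funM => //; apply/measurable_EFinP.
  exact: measurableT_comp.
have := @dominated_convergence _ _ _ mu _ measurableT h (cst 0)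
  (fun x => `|g x|%:E * w x) mh.
case.
- exact: measurable_cst.
- apply: aeW => x _; apply: cvg_near_cst; near=> n.
  rewrite /h /funrpos /= max_r ?mule0// subr_le0.
  by near: n; exact: nbhs_infty_ger.
- apply/integrableP; split => //.
  by under eq_integral do rewrite gee0_abs ?mule_ge0 ?lee_fin//.
- apply: aeW => x n _; rewrite gee0_abs// /h muleC lee_wpmul2r// lee_fin.
  rewrite /funrpos /= ge_max normr_ge0 andbT.
  by rewrite (le_trans _ (ler_norm _))// lerBlDr lerDl.
rewrite integral0 => _ _ hn0; have [[n hne]|hne] :=
  pselect (exists n, \int[mu]_x h n x <= e%:E); first by exists n%:R.
suff : e%:E <= 0 by rewrite lee_fin leNgt e0.
apply: (cvge_to_ge hn0); apply: nearW => n; rewrite leNgt; apply/negP => /ltW.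
by move=> hle; apply: hne; exists n.
Unshelve. all: by end_near. Qed.

(** The supremum of int g q over 0 <= q <= w of mass c is approached by
    filling superlevel sets of g: the slack of such a q can be made
    arbitrarily small. *)
Lemma bathtub w g (c e : R) :
  measurable_fun setT w -> measurable_fun setT g -> (forall x, 0 <= w x) ->
  \int[mu]_x (`|g x|%:E * w x) < +oo ->
  (0 <= c)%R -> c%:E <= \int[mu]_x w x -> (0 < e)%R ->
  exists q lam, [/\ measurable_fun setT q,
    forall x, (0 <= q x)%R /\ (q x)%:E <= w x,
    \int[mu]_x (q x)%:E = c%:E & slack w q g lam <= e%:E].
Proof.
move=> mw mg w0 gw c0 cw e0.
have mG lam : measurable [set x | (lam < g x)%R].
  by rewrite -[X in measurable X]setTI -preimage_itvoy; exact: mg.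
(* c = 0: only q = 0 is possible, and lam is taken large *)
have [c00|cn0] := eqVneq c 0%R.
  have [lam tail] := tail_vanishes mw mg w0 gw e0.
  exists (cst 0%R), lam; split => //.
  + by rewrite c00 integral0.
  + apply: le_trans tail; rewrite /slack.
    by under eq_integral do rewrite mul0e add0e sube0.
have cp : (0 < c)%R by rewrite lt0r cn0.
(* c = int w: q is w almost everywhere, and lam is taken very negative, which
   is the previous situation for - g *)
have [cwE|cltw] := eqVneq c%:E (\int[mu]_x w x).
  have mNg : measurable_fun setT (\- g)%R by exact: measurableT_comp.
  have [|lam tail] := tail_vanishes mw mNg w0 _ e0.
    by under eq_integral do rewrite /= normrN.
  have [||q [mq qw _ qI qae]] := exists_interpolation (c := c) mw w0
    measurableT measurableT (@subset_refl _ _).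
  + by rewrite cwE.
  + by rewrite cwE.
  exists q, (- lam)%R; split => //; apply: le_trans tail.
  apply: ae_ge0_le_integral => //.
  + by move=> x _; case: (qw x) => ? ?; exact: slack_integrand_ge0.
  + exact: measurable_slack.
  + by move=> x _; rewrite mule_ge0 ?lee_fin ?funrpos_ge0.
  + apply: emeasurable_funM => //; apply/measurable_EFinP/measurable_funrpos.
    exact: measurable_funB.
  apply: filterS qae => x qwx _; rewrite -qwx// subee// mul0e adde0.
  rewrite /funrneg /funrpos /= (_ : - g x - lam = - (g x - - lam))%R//.
  by rewrite opprB addrC.
have {}cltw : c%:E < \int[mu]_x w x by rewrite lt_neqAle cltw.
pose B lam := \int[mu]_(x in [set x | (lam < g x)%R]) w x.
have ndB s t : (s <= t)%R -> B t <= B s.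
  move=> st; apply: ge0_subset_integral => //.
    exact: measurable_funTS.
  by move=> x /=; exact: le_lt_trans.
(* B tends to 0 at +oo, as w <= w (g - lam)^+ on {lam + 1 < g} *)
have [lam0 Blam0] : exists lam, B lam <= c%:E.
  have [lam tail] := tail_vanishes mw mg w0 gw cp.
  exists (lam + 1)%R; apply: le_trans tail; rewrite /B integral_mkcond.
  apply: ge0_le_integral => //.
  + by move=> x _; rewrite patchE; case: ifP.
  + by apply/measurable_restrict => //; exact: measurable_funTS.
  + apply: emeasurable_funM => //; apply/measurable_EFinP/measurable_funrpos.
    exact: measurable_funB.
  move=> x _; rewrite patchE; case: ifPn => [/set_mem /= lg|_].
    rewrite -[leLHS]mule1 lee_wpmul2l// lee_fin /funrpos /= le_max; apply/orP.
    by left; rewrite lerBrDr addrC ltW.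
  by rewrite mule_ge0 ?lee_fin ?funrpos_ge0.
(* B tends to int w > c at -oo, as the superlevel sets exhaust the space *)
have [lam1 Blam1] : exists lam, c%:E < B lam.
  have [//|nB] := pselect (exists lam, c%:E < B lam).
  exfalso; move: cltw; rewrite ltNge => /negP; apply.
  pose F (n : nat) := [set x | (- n%:R < g x)%R].
  have -> : \int[mu]_x w x = \int[mu]_(x in \bigcup_n F n) w x.
    congr (integral _ _ _); apply/esym/seteqP; split => // x _.
    exists (Num.truncn `|g x|).+1 => //; rewrite /F /= ltrNl.
    rewrite (le_lt_trans (ler_norm _))// normrN.
    exact: truncnS_gt.
  have ndF : {homo F : n m / (n <= m)%N >-> (n <= m)%O}.
    move=> n m nm; apply/subsetPset => x /=; apply: le_lt_trans.
    by rewrite lerN2 ler_nat.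
  have := @ge0_nondecreasing_set_cvg_integral _ _ _ F w mu ndF (fun n => mG _).
  move=> /(_ (fun n => measurable_funTS mw) (fun n x _ => w0 x)).
  move=> /cvge_to_le; apply; apply: nearW => n; rewrite leNgt; apply/negP => h.
  by apply: nB; exists (- n%:R)%R.
(* a slab of width e / c contributes at most e, its mass being at most c *)
have ec0 : (0 < e / c)%R by rewrite divr_gt0.
pose S := [set lam | B lam <= c%:E].
have hS : has_inf S.
  split; first by exists lam0.
  exists lam1 => lam /= Blam; rewrite leNgt; apply/negP => /ltW /ndB.
  by move=> /(lt_le_trans Blam1); rewrite ltNge Blam.
have [lam Slam lamlt] := inf_adherent ec0 hS.
have Blame : c%:E <= B (lam - e / c)%R.
  rewrite leNgt; apply/negP => /ltW Sle.
  have : (inf S <= lam - e / c)%R by apply: ge_inf => //; case: hS.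
  by rewrite leNgt ltrBlDr lamlt.
have [|q [mq qw q0 qI qae]] := exists_interpolation (c := c) mw w0
    (mG lam) (mG (lam - e / c)%R) _ Slam Blame.
  by move=> x /=; apply: lt_trans; rewrite ltrBlDr ltrDl.
exists q, lam; split => //.
apply: (le_trans (slack_le mw mq mg qw (ltW ec0) qae q0)).
by rewrite qI -EFinM divfK.
Qed.
End bathtub.

(** * Duality for the density bounds *)

Section duality.
Context d (T : measurableType d) (R : realType) (mu : {measure set T -> \bar R})
  (sfmu : sigma_finite [set: T] mu) (Xi : set T) (l u : T -> \bar R) (g : T -> R).
Context (mXi : measurable Xi) (mg : measurable_fun setT g)
  (ml : measurable_fun Xi l) (mu' : measurable_fun Xi u)
  (l_ge0 : forall x, Xi x -> 0 <= l x) (l_le_u : forall x, Xi x -> l x <= u x)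
  (gu_fin : \int[mu]_(x in Xi) (`|g x|%:E * u x) < +oo).

Definition feasible (p : T -> R) : Prop :=
  [/\ measurable_fun setT p, forall x, (0 <= p x)%R,
      forall x, Xi x -> l x <= (p x)%:E <= u x & \int[mu]_(x in Xi) (p x)%:E = 1].

Definition dual_value (lam : R) : \bar R :=
  lam%:E - \int[mu]_(x in Xi) (l x * ((g \- cst lam)^\-%R x)%:E)
         + \int[mu]_(x in Xi) (u x * ((g \- cst lam)^\+%R x)%:E).

(** Since p has mass 1, the primal value is
    lam + int p (g - lam)^+ - int p (g - lam)^-, and both integrals are finite.
    Splitting p = l + (p - l) in the second and u = p + (u - p) in the dual
    objective leaves the slack; int u (g - lam)^+ may be infinite, so the
    splitting is done between nonnegative integrals. *)
Lemma dual_valueE (lam : R) p : feasible p ->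
  dual_value lam = \int[mu]_(x in Xi) (g x * p x)%:E +
    \int[mu]_(x in Xi) (((p x)%:E - l x) * ((g \- cst lam)^\-%R x)%:E +
                        (u x - (p x)%:E) * ((g \- cst lam)^\+%R x)%:E).
Proof.
move=> [mp p0 lpu p1]; rewrite /dual_value.
set N := (g \- cst lam)^\-%R; set P := (g \- cst lam)^\+%R.
have mgl : measurable_fun Xi (g \- cst lam)%R.
  by apply: measurable_funTS; exact: measurable_funB.
have mN : measurable_fun Xi N by exact: measurable_funrneg.
have mP : measurable_fun Xi P by exact: measurable_funrpos.
have mpX : measurable_fun Xi p by exact: measurable_funTS.
have mgX : measurable_fun Xi g by exact: measurable_funTS.
have mE (f : T -> R) :
    measurable_fun Xi f -> measurable_fun Xi (fun x => (f x)%:E).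
  by move=> mf; exact/measurable_EFinP.
have N0 x : (0 <= N x)%R by exact: funrneg_ge0.
have P0 x : (0 <= P x)%R by exact: funrpos_ge0.
have PBN x : (P x - N x = g x - lam)%R.
  by rewrite -[RHS]/((g \- cst lam)%R x) -[in RHS](funrposBneg (g \- cst lam)%R).
have PDN x : (P x + N x = `|g x - lam|)%R.
  by have /(congr1 (@^~ x)) := funrposDneg (g \- cst lam)%R.
have ip : mu.-integrable Xi (fun x => (p x)%:E).
  apply/integrableP; split; first exact: mE.
  under eq_integral do rewrite gee0_abs ?lee_fin//.
  by rewrite p1 ltry.
have igp : mu.-integrable Xi (fun x => (g x * p x)%:E).
  apply/integrableP; split; first exact/mE/measurable_funM.
  apply: le_lt_trans gu_fin; apply: ge0_le_integral => //.
  - apply: measurableT_comp => //; exact/mE/measurable_funM.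
  - by apply: emeasurable_funM => //; apply/mE/measurableT_comp.
  move=> x Xx; rewrite abse_EFin normrM EFinM lee_wpmul2l ?lee_fin//.
  by rewrite ger0_norm//; case/andP: (lpu x Xx).
(* (g - lam)^+ and (g - lam)^- are at most |g| + |lam| *)
have ipart (h : T -> R) : measurable_fun Xi h ->
    (forall x, (0 <= h x <= P x + N x)%R) ->
    mu.-integrable Xi (fun x => (p x * h x)%:E).
  move=> mh hle.
  apply: (@le_integrable _ _ _ mu Xi mXi _
    ((fun x => `|(g x * p x)%:E|) \+ (fun x => `|lam|%:E * (p x)%:E))).
  - exact/mE/measurable_funM.
  - move=> x Xx /=; have /andP[h0 hx] := hle x.
    rewrite lee_fin (ger0_norm (mulr_ge0 (p0 x) h0)) ger0_norm; last first.
      by rewrite addr_ge0 ?mulr_ge0.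
    rewrite normrM (ger0_norm (p0 x)) -mulrDl mulrC ler_wpM2r//.
    by rewrite (le_trans hx)// PDN (le_trans (ler_normB _ _)).
  - apply: integrableD => //; first exact: integrable_abse.
    exact: integrableZl.
have ipP : mu.-integrable Xi (fun x => (p x * P x)%:E).
  by apply: ipart => // x; rewrite P0 lerDl N0.
have ipN : mu.-integrable Xi (fun x => (p x * N x)%:E).
  by apply: ipart => // x; rewrite N0 lerDr P0.
have lN0 x : Xi x -> 0 <= l x * (N x)%:E.
  by move=> Xx; rewrite mule_ge0 ?lee_fin// l_ge0.
have plN0 x : Xi x -> 0 <= ((p x)%:E - l x) * (N x)%:E.
  move=> Xx; rewrite mule_ge0 ?lee_fin// sube_ge0 ?orbT//.
  by case/andP: (lpu x Xx).
have upP0 x : Xi x -> 0 <= (u x - (p x)%:E) * (P x)%:E.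
  move=> Xx; rewrite mule_ge0 ?lee_fin// sube_ge0//.
  by case/andP: (lpu x Xx).
have mpl : measurable_fun Xi (fun x => ((p x)%:E - l x) * (N x)%:E).
  by apply: emeasurable_funM; [apply: emeasurable_funB|]; rewrite //; exact: mE.
have mup : measurable_fun Xi (fun x => (u x - (p x)%:E) * (P x)%:E).
  by apply: emeasurable_funM; [apply: emeasurable_funB|]; rewrite //; exact: mE.
have mlN : measurable_fun Xi (fun x => l x * (N x)%:E).
  by apply: emeasurable_funM => //; exact: mE.
have uPE : \int[mu]_(x in Xi) (u x * (P x)%:E) =
    \int[mu]_(x in Xi) (p x * P x)%:E +
    \int[mu]_(x in Xi) ((u x - (p x)%:E) * (P x)%:E).
  rewrite -ge0_integralD//.
  - apply: eq_integral => x /set_mem Xx.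
    rewrite EFinM -ge0_muleDl ?lee_fin//; last first.
      by rewrite sube_ge0//; case/andP: (lpu x Xx).
    by rewrite [(p x)%:E + _]addeC subeK.
  - by move=> x _; rewrite lee_fin mulr_ge0.
  - exact/mE/measurable_funM.
have pNE : \int[mu]_(x in Xi) (p x * N x)%:E =
    \int[mu]_(x in Xi) (l x * (N x)%:E) +
    \int[mu]_(x in Xi) (((p x)%:E - l x) * (N x)%:E).
  rewrite -ge0_integralD//.
  apply: eq_integral => x /set_mem Xx.
  have /andP[lp _] := lpu x Xx.
  rewrite EFinM -ge0_muleDl ?l_ge0//; last by rewrite sube_ge0 ?orbT.
  have lfin : l x \is a fin_num.
    by rewrite ge0_fin_numE ?l_ge0// (le_lt_trans lp)// ltry.
  by rewrite [l x + _]addeC subeK.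
have gpE : \int[mu]_(x in Xi) (p x * P x)%:E - \int[mu]_(x in Xi) (p x * N x)%:E =
    \int[mu]_(x in Xi) (g x * p x)%:E - lam%:E.
  rewrite -integralB_EFin//.
  rewrite -[X in _ = _ - X]mule1 -p1 -integralZl// -integralB//; last first.
    exact: integrableZl.
  apply: eq_integral => x _ /=; congr EFin.
  by rewrite -mulrBr PBN mulrBr mulrC [(p x * lam)%R]mulrC.
rewrite uPE ge0_integralD//.
have L0 : 0 <= \int[mu]_(x in Xi) (l x * (N x)%:E) by exact: integral_ge0.
have L'0 : 0 <= \int[mu]_(x in Xi) (((p x)%:E - l x) * (N x)%:E).
  exact: integral_ge0.
have U'0 : 0 <= \int[mu]_(x in Xi) ((u x - (p x)%:E) * (P x)%:E).
  exact: integral_ge0.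
(* all the integrals but the last are finite, so this is real arithmetic *)
move: gpE pNE L0 L'0 U'0 (integrable_fin_num mXi igp)
  (integrable_fin_num mXi ipP) (integrable_fin_num mXi ipN).
case: (\int[mu]_(x in Xi) (g x * p x)%:E) => // a.
case: (\int[mu]_(x in Xi) (p x * P x)%:E) => // b.
case: (\int[mu]_(x in Xi) (p x * N x)%:E) => // b'.
case: (\int[mu]_(x in Xi) (l x * (N x)%:E)) => // [L|]; last first.
  by case: (\int[mu]_(x in Xi) (((p x)%:E - l x) * (N x)%:E)).
case: (\int[mu]_(x in Xi) (((p x)%:E - l x) * (N x)%:E)) => // L'.
case: (\int[mu]_(x in Xi) ((u x - (p x)%:E) * (P x)%:E)) => // U' .
rewrite -!EFinD => -[ab] -[bL] _ _ _ _ _ _.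
by congr EFin; lra.
Qed.

Lemma weak_duality lam p : feasible p ->
  \int[mu]_(x in Xi) (g x * p x)%:E <= dual_value lam.
Proof.
move=> Dp; rewrite (dual_valueE lam Dp) leeDl// integral_ge0// => x Xx.
case: Dp => _ _ /(_ x Xx) /andP[lp pu] _.
by rewrite adde_ge0// mule_ge0 ?lee_fin ?funrneg_ge0 ?funrpos_ge0//
  sube_ge0 ?orbT.
Qed.

(** The bathtub principle applied to w = u - l and c = 1 - int l, with w
    extended by 0 outside Xi. A density exists, so l is finite on Xi and
    int l <= 1 <= int u, that is, 0 <= c <= int w. *)
Lemma near_optimal_density (e : R) : (exists p, feasible p) -> (0 < e)%R ->
  exists p lam, feasible p /\
    dual_value lam <= \int[mu]_(x in Xi) (g x * p x)%:E + e%:E.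
Proof.
move=> [p0 [mp0 p00 lp0u p01]] e0.
have u0 x : Xi x -> 0 <= u x by move=> Xx; exact: le_trans (l_ge0 Xx) (l_le_u Xx).
have lfin x : Xi x -> l x \is a fin_num.
  move=> Xx; rewrite ge0_fin_numE ?l_ge0//.
  by have /andP[lp _] := lp0u x Xx; rewrite (le_lt_trans lp)// ltry.
have mgX : measurable_fun Xi g by exact: measurable_funTS.
have mp0E : measurable_fun Xi (fun x => (p0 x)%:E).
  by apply/measurable_EFinP; exact: measurable_funTS.
have l1 : \int[mu]_(x in Xi) l x <= 1.
  rewrite -p01; apply: ge0_le_integral => //.
  by move=> x Xx; case/andP: (lp0u x Xx).
have u1 : 1 <= \int[mu]_(x in Xi) u x.
  rewrite -p01; apply: ge0_le_integral => //.
    by move=> x _; rewrite lee_fin.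
  by move=> x Xx; case/andP: (lp0u x Xx).
have Ifin : \int[mu]_(x in Xi) l x \is a fin_num.
  by rewrite ge0_fin_numE ?integral_ge0// (le_lt_trans l1)// ltry.
set I := fine (\int[mu]_(x in Xi) l x).
have IE : \int[mu]_(x in Xi) l x = I%:E by rewrite fineK.
pose w := (u \- l) \_ Xi.
have ul0 x : Xi x -> 0 <= u x - l x by move=> Xx; rewrite sube_ge0 ?lfin// l_le_u.
have mul : measurable_fun Xi (u \- l) by exact: emeasurable_funB.
have mw : measurable_fun setT w by apply/measurable_restrict; rewrite ?setTI.
have w0 x : 0 <= w x.
  by rewrite /w patchE; case: ifPn => // /set_mem; exact: ul0.
have gw : \int[mu]_x (`|g x|%:E * w x) < +oo.
  have mgE : measurable_fun Xi (fun x => `|g x|%:E).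
    exact/measurable_EFinP/measurableT_comp.
  rewrite (_ : (fun x => _) = (fun x => `|g x|%:E * (u x - l x)) \_ Xi); last first.
    by apply/funext => x; rewrite /w !patchE; case: ifPn; rewrite ?mule0.
  rewrite -integral_mkcond; apply: le_lt_trans gu_fin.
  apply: ge0_le_integral => //.
  - by move=> x Xx; rewrite mule_ge0 ?lee_fin// ul0.
  - exact: emeasurable_funM.
  - exact: emeasurable_funM.
  by move=> x Xx; rewrite lee_wpmul2l ?lee_fin// leeBlDr ?lfin// leeDl// l_ge0.
have c0 : (0 <= 1 - I)%R by rewrite subr_ge0 -lee_fin -IE.
have cw : (1 - I)%:E <= \int[mu]_x w x.
  rewrite -integral_mkcond EFinB leeBlDl// -IE -ge0_integralD//.
  rewrite (_ : integral _ _ _ = \int[mu]_(x in Xi) u x)//.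
  by apply: eq_integral => x /set_mem Xx; rewrite addeC subeK ?lfin.
have [q [lam [mq qw qI qslack]]] :=
  bathtub sfmu mw mg w0 gw c0 cw e0.
have q0 x : ~ Xi x -> q x = 0%R.
  move=> nXx; have [q0 ] := qw x; rewrite /w patchE memNset// lee_fin => qle.
  by apply/eqP; rewrite eq_le qle q0.
pose p := ((fun x => fine (l x) + q x)%R : T -> R) \_ Xi.
have pE x : Xi x -> (p x)%:E = l x + (q x)%:E.
  by move=> Xx; rewrite /p patchE mem_set// EFinD fineK ?lfin.
have Dp : feasible p.
  split => [|x|x Xx|].
  - apply/measurable_restrict; rewrite ?setTI//.
    apply: measurable_funD; first exact: measurableT_comp.
    exact: measurable_funTS.
  - rewrite /p patchE; case: ifPn => // /set_mem Xx.
    by rewrite addr_ge0 ?fine_ge0 ?l_ge0//; case: (qw x).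
  - have [qx0] := qw x; rewrite /w patchE mem_set//= => qul.
    rewrite pE// leeDl ?lee_fin//= addeC.
    by rewrite -leeBrDr ?lfin.
  - rewrite (eq_integral (fun x => l x + (q x)%:E)); last first.
      by move=> x /set_mem; exact: pE.
    rewrite ge0_integralD//; first last.
    + by apply/measurable_EFinP; exact: measurable_funTS.
    + by move=> x _; rewrite lee_fin; case: (qw x).
    rewrite IE integral_mkcond (eq_integral (fun x => (q x)%:E)).
      by rewrite qI -EFinD subrKC.
    move=> x _; rewrite patchE; case: ifPn => // /negP nXx; rewrite q0//.
    by move/mem_set.
exists p, lam; split => //; rewrite (dual_valueE lam Dp) leeD2l//.
apply: le_trans qslack; rewrite /slack integral_mkcond.
rewrite le_eqVlt; apply/orP; left; apply/eqP; apply: eq_integral => x _.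
rewrite /w !patchE; case: ifPn => [/set_mem Xx|/negP nXx]; last first.
  by rewrite q0 ?sube0 ?mul0e ?adde0// => /mem_set.
rewrite pE//; have := lfin x Xx; case: (l x) => // r _.
by rewrite fin_num_oppeD// addeA [r%:E + _]addeC addeK.
Qed.

End duality.

(** * Sigma-finiteness of Lebesgue measure *)

Section lebesgue_sigma_finite.
Context (R : realType) (m : nat).
Local Notation pt := 'rV[R]_m.

(** The map need not be injective: choosing one preimage for each point of the
    image turns the left-hand side into a sum over a subset of P. *)
Lemma esum_image_le (T T' : choiceType) (P : set T) (e : T -> T')
    (a : T' -> \bar R) : (forall j, 0 <= a j) ->
  \esum_(j in e @` P) a j <= \esum_(i in P) a (e i).
Proof.
move=> a0; have [->|/set0P[i0 _]] := eqVneq P set0.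
  by rewrite image_set0 !esum_set0.
have /choice[s sP] j : exists i, (e @` P) j -> P i /\ e i = j.
  have [[i Pi eij]|nPj] := pselect ((e @` P) j); first by exists i.
  by exists i0.
have sinj : set_inj (e @` P) s.
  move=> j k /set_mem /sP[_ ej] /set_mem /sP[_ ek] sjk.
  by rewrite -ej -ek sjk.
rewrite (_ : esum _ _ = \esum_(j in e @` P) a (e (s j))); last first.
  by apply: eq_esum => j /sP[_ ->].
rewrite -(@esum_image _ _ _ _ _ (a \o e) sinj); apply: ge_ereal_sup => _ [X [finX XP] <-].
apply: ereal_sup_ubound; exists X => //; split => // i /XP[j /sP[Psj _] <-].
exact: Psj.
Qed.

(** The part of a box in the half-space where coordinate i is at most c. It may
    come out with reversed endpoints, for which [box_volume] is 0. *)
Definition cut_below (i : 'I_m) (c : R) (ab : pt * pt) : pt * pt :=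
  (ab.1, \row_j if j == i then Num.min (ab.2 ord0 j) c else ab.2 ord0 j).

Definition cut_above (i : 'I_m) (c : R) (ab : pt * pt) : pt * pt :=
  (\row_j if j == i then Num.max (ab.1 ord0 j) c else ab.1 ord0 j, ab.2).

Lemma box_cut_below i c ab x : box ab x -> (x ord0 i <= c)%R ->
  box (cut_below i c ab) x.
Proof.
move=> abx xc j; have /andP[ax xb] := abx j; rewrite /= mxE ax /=.
by case: eqP => [->|//]; rewrite le_min xc andbT; have /andP[] := abx i.
Qed.

Lemma box_cut_above i c ab x : box ab x -> (c < x ord0 i)%R ->
  box (cut_above i c ab) x.
Proof.
move=> abx xc j; have /andP[ax xb] := abx j; rewrite /= mxE xb andbT.
by case: eqP => [->|//]; rewrite gt_max xc andbT; have /andP[] := abx i.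
Qed.

Lemma length_cut (a b c : R) :
  (Num.max (Num.min b c - a) 0 + Num.max (b - Num.max a c) 0 =
   Num.max (b - a) 0)%R.
Proof.
have [bc|cb] := leP b c; have [ac|ca] := leP a c.
- by rewrite [X in (_ + X)%R]max_r ?addr0// subr_le0.
- by rewrite [X in (_ + X)%R]max_r ?addr0// subr_le0 (le_trans bc) ?ltW.
- rewrite !(@max_l _ _ _ 0%R) ?subr_ge0//; first by rewrite addrC subrKA.
  + exact: le_trans (ltW cb).
  + exact: ltW.
- by rewrite max_r ?add0r// subr_le0 ltW.
Qed.

Lemma box_volume_cut i c ab : (box_volume (cut_below i c ab) +
  box_volume (cut_above i c ab) = box_volume ab)%R.
Proof.
rewrite /box_volume [X in (X + _)%R](bigD1 i)// [X in (_ + X)%R](bigD1 i)//.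
rewrite [RHS](bigD1 i)//= !mxE eqxx.
under eq_bigr => j /negbTE ji do rewrite mxE ji.
under [X in (_ + _ * X)%R]eq_bigr => j /negbTE ji do rewrite mxE ji.
rewrite -mulrDl; congr (_ * _)%R.
exact: length_cut.
Qed.

(** A cover of X by boxes is cut into covers of its two parts, and cutting
    preserves the volume of each box. *)
Lemma measurable_half_space (i : 'I_m) (c : R) :
  measurable ([set x | (x ord0 i <= c)%R] : set (lebesgue_rV R m)).
Proof.
apply: le_caratheodory_measurable => X.
apply: le_ereal_inf_tmp => _ [C [cC XC] <-].
have vol0 (ab : pt * pt) : 0 <= (box_volume ab)%:E by rewrite lee_fin box_volume_ge0.
have cover A e : (forall ab x, A x -> box ab x -> box (e ab) x) ->
    lebesgue_outer (X `&` A) <= \esum_(ab in C) (box_volume (e ab))%:E.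
  move=> Ae; apply: (le_trans _ (esum_image_le C e vol0)).
  apply: ereal_inf_lbound; exists (e @` C) => //; split.
    exact: sub_countable (card_image_le e C) cC.
  move=> x [/XC[ab Cab abx] Ax]; exists (e ab); first by exists ab.
  exact: Ae.
apply: le_trans (leeD (cover _ (cut_below i c) _) (cover _ (cut_above i c) _)) _.
- by move=> ab x xc abx; exact: box_cut_below.
- by move=> ab x /negP; rewrite -ltNge => xc abx; exact: box_cut_above.
rewrite -esumD//; apply: le_esum => ab _.
by rewrite -EFinD box_volume_cut.
Qed.

Lemma measurable_box ab : measurable (box ab : set (lebesgue_rV R m)).
Proof.
rewrite (_ : box ab = \bigcap_(i in [set: 'I_m])
   ([set x : lebesgue_rV R m | (x ord0 i <= ab.2 ord0 i)%R] `\`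
    [set x | (x ord0 i <= ab.1 ord0 i)%R])); last first.
  apply/seteqP; split => [x abx i _|x abx i].
    by have /andP[ax xb] := abx i; split => //=; apply/negP; rewrite -ltNge.
  by have [xb /negP] := abx i Logic.I; rewrite -ltNge => ax; apply/andP.
apply: fin_bigcap_measurable => // i _.
by apply: measurableD; exact: measurable_half_space.
Qed.

Lemma lebesgue_rV_sigma_finite :
  sigma_finite [set: lebesgue_rV R m] (lebesgue_rV_measure R m).
Proof.
exists (fun n => box (const_mx (- n%:R)%R, const_mx n%:R)).
  apply/esym/seteqP; split => // x _.
  pose s := (\sum_(i < m) `|x ord0 i|)%R.
  exists (Num.truncn s).+1 => // i; rewrite !mxE.
  have : (`|x ord0 i| < (Num.truncn s).+1%:R)%R.
    apply: (le_lt_trans _ (truncnS_gt _)).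
    by rewrite /s (bigD1 i)//= lerDl sumr_ge0.
  by rewrite ltr_norml => /andP[-> /ltW].
move=> n; split; first exact: measurable_box.
set ab := (_, _).
apply: (@le_lt_trans _ _ (box_volume ab)%:E); last exact: ltry.
apply: ereal_inf_lbound; exists [set ab]; last first.
  by rewrite esum_set1// lee_fin box_volume_ge0.
split; first exact: countable1.
by rewrite bigcup_set1.
Qed.
End lebesgue_sigma_finite.

(** * Strong duality for Lebesgue densities *)

(** On Lebesgue space [feasible] and [dual_value] unfold to the predicate
    [densities] and the function [dual_objective], so near-optimal densities
    give one inequality and weak duality the other. *)
Lemma strong_duality (R : realType) (m : nat) (Xi : set (lebesgue_rV R m))
    (l u : lebesgue_rV R m -> \bar R) (g : lebesgue_rV R m -> R) :
  measurable Xi -> measurable_fun setT g ->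
  measurable_fun Xi l -> measurable_fun Xi u ->
  (forall x, Xi x -> 0 <= l x) -> (forall x, Xi x -> l x <= u x) ->
  \int[lebesgue_rV_measure R m]_(x in Xi) (`|g x|%:E * u x) < +oo ->
  densities Xi l u !=set0 ->
  worst_case Xi l u g =
  ereal_inf [set dual_objective Xi l u g lam | lam in [set: R]].
Proof.
move=> mXi mg ml mu l0 lu gu D0; apply/eqP; rewrite eq_le; apply/andP; split.
  apply: ge_ereal_sup => _ [p Dp <-]; apply: le_ereal_inf_tmp => _ [lam _ <-].
  exact: (weak_duality mXi mg ml mu l0 gu lam Dp).
apply/lee_addgt0Pr => e e0.
have [p [lam [Dp dualp]]] :=
  near_optimal_density (@lebesgue_rV_sigma_finite R m) mXi mg ml mu l0 lu gu D0 e0.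
apply: (@le_trans _ _ (dual_objective Xi l u g lam)).
  by apply: ereal_inf_lbound; exists lam.
apply: le_trans dualp _; rewrite leeD2r//; apply: ereal_sup_ubound.
by exists p.
Qed.

Theorem mainTheorem3 (R : realType) (n m : nat)
    (X : set 'rV[R]_n) (Xi : set (lebesgue_rV R m))
    (f : 'rV[R]_n -> lebesgue_rV R m -> R)
    (l u : lebesgue_rV R m -> \bar R)
    (mXi : measurable Xi)
    (mf : forall x, X x -> measurable_fun [set: lebesgue_rV R m] (f x))
    (ml : measurable_fun Xi l) (mu : measurable_fun Xi u)
    (l_ge0 : forall xi, Xi xi -> 0 <= l xi)
    (u_ge0 : forall xi, Xi xi -> 0 <= u xi)
    (l_le_u : forall xi, Xi xi -> l xi <= u xi)
    (fu_fin : forall x, X x ->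
      \int[lebesgue_rV_measure R m]_(xi in Xi) (`|f x xi|%:E * u xi) < +oo)
    (D_neq0 : densities Xi l u !=set0) :
  (forall x, X x ->
    worst_case Xi l u (f x) =
    ereal_inf [set dual_objective Xi l u (f x) lambda | lambda in [set: R]]) /\
  ereal_inf [set worst_case Xi l u (f x) | x in X] =
  ereal_inf [set dual_objective Xi l u (f x) lambda
            | x in X & lambda in [set: R]].
Proof.
have dual x : X x -> worst_case Xi l u (f x) =
    ereal_inf [set dual_objective Xi l u (f x) lambda | lambda in [set: R]].
  by move=> Xx; apply: strong_duality => //; [exact: mf|exact: fu_fin].
split => //; apply/eqP; rewrite eq_le; apply/andP; split.
  apply: le_ereal_inf_tmp => _ [x Xx [lam _ <-]].
  apply: (@le_trans _ _ (worst_case Xi l u (f x))).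
    by apply: ereal_inf_lbound; exists x.
  by rewrite dual//; apply: ereal_inf_lbound; exists lam.
apply: le_ereal_inf_tmp => _ [x Xx <-]; rewrite dual//.
apply: ereal_inf_le_tmp => _ [lam _ <-].
by exists x => //; exists lam.
Qed.
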